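(* Let $X$ and $Y$ be infinite-dimensional homogeneous Hilbertian operator spaces. If there is a completely Lipschitz in small scale embedding $B_X\to Y$, then $\kappa_n(X)\simeq\kappa_n(Y)$.
   Context: Operator spaces are complex: an operator space is a closed linear subspace $X\subseteq \mathcal B(H)$, $H$ a complex Hilbert space, with $\mathrm M_n(X)$ normed through $\mathrm M_n(X)\subseteq \mathrm M_n(\mathcal B(H))\cong\mathcal B(H^{\oplus n})$. $B_E$ is the closed unit ball of $E$. For a map $f$, $f_n([x_{ij}])=[f(x_{ij})]$; for linear $u$, $\|u\|_{\rm cb}=\sup_n\|u_n\|$. An operator space $X$ is Hilbertian if it is linearly isometric to a Hilbert space, and homogeneous if $\|u\|_{\rm cb}=\|u\|$ for every bounded linear $u\colon X\to X$. For a homogeneous Hilbertian operator space $X$ with $\dim X\ge n$, $\kappa_n(X)$ is the norm in $\mathrm M_n(X)$ of the matrix whose first column is $(e_1,\dots,e_n)^T$ and whose other entries are $0$, where $\{e_1,\dots,e_n\}$ is any orthonormal set in $X$ (the value does not depend on the choice). A map $f\colon B_X\to Y$ is a completely Lipschitz in small scale embedding if there is $L\ge1$ such that $\frac1L\|x-y\|_{\mathrm M_n(X)}\le\|f_n(x)-f_n(y)\|_{\mathrm M_n(Y)}\le L\|x-y\|_{\mathrm M_n(X)}$ for all $n\in\mathbb N$ and all $x,y\in B_{\mathrm M_n(X)}$. For positive sequences, $a_n\simeq b_n$ means there is $L\ge1$ with $a_n/L\le b_n\le La_n$ for all $n\in\mathbb N$. *)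

(* Defs.v *)
From HB Require Import structures.
From mathcomp Require Import all_boot all_order all_algebra.
From mathcomp Require Import complex.
From mathcomp Require Import all_classical all_reals all_analysis.

Set Implicit Arguments.
Unset Strict Implicit.
Unset Printing Implicit Defensive.

Import Order.TTheory GRing.Theory Num.Theory.
Import numFieldNormedType.Exports.
Local Open Scope classical_set_scope.
Local Open Scope ring_scope.
Local Open Scope complex_scope.

(* Complex Hilbert spaces; the inner product is linear in its first argument. *)
Record hilbert (R : realType) := Hilbert {
  hilbert_sort :> completeNormedModType R[i];
  inner : {dot hilbert_sort for Num.conj};
  inner_norm : forall x : hilbert_sort, inner x x = `|x| ^+ 2 }.

Section OperatorNorm.
Variable R : realType.

(* Norms of normed modules over R[i] are R[i]-valued (with zero imaginary
   part); hnorm is the corresponding R-valued norm. *)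
Definition hnorm (H : hilbert R) (x : H) : R := complex.Re `|x|.

(* sup of the norms of T v over the closed unit ball; it is +oo when the
   linear map T is unbounded *)
Definition opnorm (V W : Type) (normV : V -> R) (normW : W -> R)
    (T : V -> W) : \bar R :=
  ereal_sup [set (normW (T v))%:E | v in [set v | normV v <= 1]].

(* The set B(H). *)
Definition bounded_operators (H : hilbert R) : set (H -> H) :=
  [set T | linear T /\ (opnorm (@hnorm H) (@hnorm H) T < +oo)%E].

(* The norm of the Hilbertian direct sum of n copies of H. *)
Definition l2norm (H : hilbert R) (n : nat) (h : 'cV[H]_n) : R :=
  Num.sqrt (\sum_i hnorm (h i 0) ^+ 2).

(* The identification of M_n(B(H)) with B(H^n). *)
Definition mxop (H : hilbert R) (n : nat) (T : 'M[H -> H]_n) (h : 'cV[H]_n) :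
    'cV[H]_n :=
  \col_i \sum_j T i j (h j 0).

End OperatorNorm.
Arguments bounded_operators {R} H _.

Record opspace (R : realType) := OpSpace {
  ambient : hilbert R;
  subspace : set (ambient -> ambient);
  subspace_bounded : subspace `<=` bounded_operators ambient;
  subspace0 : subspace 0;
  subspace_linear : forall (a : R[i]) S T,
    subspace S -> subspace T -> subspace (a *: S + T);
  subspace_closed : forall T, bounded_operators ambient T ->
    (forall e : R, 0 < e -> exists2 S, subspace S &
       (opnorm (@hnorm R ambient) (@hnorm R ambient) (T - S)%R <= e%:E)%E) ->
    subspace T }.

(* An operator space X is used below as the left R[i]-module of its elements;
   val : X -> (ambient X -> ambient X) is the inclusion in B(H). *)
Section OpSpaceType.
Variables (R : realType) (X : opspace R).

Definition opspace_pred : {pred ambient X -> ambient X} :=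
  fun T => T \in @subspace R X.

Fact opspace_submod_closed : submod_closed opspace_pred.
Proof.
split=> [|a S T]; rewrite !unfold_in; first exact/mem_set/subspace0.
by move=> /set_mem XS /set_mem XT; apply/mem_set/subspace_linear.
Qed.

HB.instance Definition _ :=
  GRing.isSubmodClosed.Build R[i] (ambient X -> ambient X) opspace_pred
    opspace_submod_closed.

Definition opspace_sort : Type := {T : ambient X -> ambient X | opspace_pred T}.

HB.instance Definition _ := SubType.on opspace_sort.
HB.instance Definition _ := Choice.on opspace_sort.
HB.instance Definition _ := [SubChoice_isSubLmodule of opspace_sort by <:].

End OpSpaceType.

Coercion opspace_sort : opspace >-> Sortclass.

Section OpSpaceTheory.
Variable R : realType.
Implicit Types X Y : opspace R.

(* opnorm is finite on the elements of X and on the matrices over X, hence the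
   use of fine in the next two definitions. *)
Definition onorm X (x : X) : R :=
  fine (opnorm (@hnorm R (ambient X)) (@hnorm R (ambient X)) (val x)).

Definition mxnorm X (n : nat) (x : 'M[X]_n) : R :=
  fine (opnorm (@l2norm R (ambient X) n) (@l2norm R (ambient X) n)
          (mxop (map_mx val x))).

(* The amplification f_n of f is map_mx f. *)
Definition cbnorm X Y (u : X -> Y) : \bar R :=
  ereal_sup [set opnorm (@mxnorm X n) (@mxnorm Y n) (map_mx u)
            | n in [set n : nat | (0 < n)%N]].

Definition infinite_dimensional X : Prop :=
  ~ exists (n : nat) (b : 'I_n -> X),
      forall x : X, exists c : 'I_n -> R[i], x = \sum_i c i *: b i.

Definition hilbert_isometry X (K : hilbert R) (J : {linear X -> K}) : Prop :=
  (forall x, hnorm (J x) = onorm x) /\ (forall k, exists x, J x = k).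

Definition hilbertian X : Prop :=
  exists (K : hilbert R) (J : {linear X -> K}), hilbert_isometry J.

Definition homogeneous X : Prop :=
  forall u : {linear X -> X}, (opnorm (@onorm X) (@onorm X) u < +oo)%E ->
    cbnorm u = opnorm (@onorm X) (@onorm X) u.

(* By polarization the choice of the isometry J does not matter. *)
Definition orthonormal_family X (n : nat) (e : 'I_n -> X) : Prop :=
  exists (K : hilbert R) (J : {linear X -> K}), hilbert_isometry J /\
    forall i j, inner K (J (e i)) (J (e j)) = (i == j)%:R.

Definition first_column X (n : nat) (e : 'I_n -> X) : 'M[X]_n :=
  \matrix_(i, j) (if val j == 0%N then e i else 0).

(* xget picks one value of the set, which is a singleton when X is a
   homogeneous Hilbertian operator space of dimension at least n. *)
Definition kappa X (n : nat) : R :=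
  xget 0 [set mxnorm (first_column e) | e in @orthonormal_family X n].

(* A map from the unit ball of X to Y is represented by a function f : X -> Y
   whose values off the ball play no role: the entries of a matrix in the unit
   ball of M_n(X) are in the unit ball of X. *)
Definition completely_lipschitz_small_scale_embedding X Y (f : X -> Y) : Prop :=
  exists2 L : R, 1 <= L &
    forall n : nat, (0 < n)%N -> forall x y : 'M[X]_n,
      mxnorm x <= 1 -> mxnorm y <= 1 ->
      L^-1 * mxnorm (x - y) <= mxnorm (map_mx f x - map_mx f y)
        <= L * mxnorm (x - y).

Definition equivalent_sequences (a b : nat -> R) : Prop :=
  exists2 L : R, 1 <= L &
    forall n : nat, (0 < n)%N -> a n / L <= b n <= L * a n.

End OpSpaceTheory.

(* Main.v *)
Require Import Defs.
From HB Require Import structures.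
From mathcomp Require Import all_boot all_order all_algebra.
From mathcomp Require Import complex ring lra.
From mathcomp Require Import all_classical all_reals all_analysis.

(** Rather than linearizing [f], the proof applies it to a small multiple of an
    orthonormal sequence and looks for orthogonality among the differences of
    the images.

    Fix [n] and let [x_k = t e_k], where [(e_k)] is orthonormal in [X] and
    [t = 1/n].  Differences [x_k - x_l] have norm [s = sqrt 2 * t], so the
    differences of the bounded sequence [f (x_k)] have norms between [s/L] and
    [L s].  Against finitely many fixed vectors of [Y], two far terms of a
    bounded sequence have nearly the same inner products, by the pigeonhole
    principle; hence a greedy choice gives pairs
    [p_0 < q_0 < p_1 < q_1 < ...] for which
    [v_i = f (x_(p_i)) - f (x_(q_i))], [i < n], are as close as desired to
    multiples [r_i g_i] of an orthonormal family
    ([almost_orthogonal_differences]), while the [x_(p_i) - x_(q_i)] are exactly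
    [s] times an orthonormal family.

    The columns [(x_(p_i))] and [(x_(q_i))] lie in the unit ball because
    [t n = 1], so [f] distorts the norm of their difference, [s * kappa_n(X)], at most by
    the factor [L]: the column [(v_i)] has norm between [s kappa_n(X) / L] and
    [L s kappa_n(X)].  On the other hand homogeneity makes diagonal maps between
    orthonormal families completely bounded with the obvious constant
    ([orthogonal_column_norm_le]); since the [r_i] are between [s/L] and [L s]
    up to a small error, the norm of [(v_i)] is between [s kappa_n(Y) / L] and
    [L s kappa_n(Y)] up to a small error ([column_norm_near_orthogonal]).
    Letting the error tend to [0] gives both comparisons with constant [L^2]. *)

Set Implicit Arguments.
Unset Strict Implicit.
Unset Printing Implicit Defensive.

Import Order.TTheory GRing.Theory Num.Theory.
Import numFieldNormedType.Exports.
Local Open Scope classical_set_scope.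
Local Open Scope ring_scope.
Local Open Scope complex_scope.

(** * Orthonormal systems in a Hilbert space *)

Section Hilbert.
Variables (R : realType) (H : hilbert R).
Implicit Types (x y : H).

Lemma hnormE x : (hnorm x)%:C = `|x|.
Proof. by rewrite RRe_real // normr_real. Qed.

Lemma hnorm_ge0 x : 0 <= hnorm x.
Proof. by rewrite -ler0c hnormE. Qed.

Lemma hnormZ (c : R) x : hnorm (c%:C *: x) = `|c| * hnorm x.
Proof.
apply: (@complexI R); rewrite rmorphM hnormE normrZ -hnormE normc_def /=.
by rewrite expr0n addr0 sqrtr_sqr.
Qed.

Lemma hnorm0 : hnorm (0 : H) = 0.
Proof. by apply: (@complexI R); rewrite hnormE normr0. Qed.

Lemma hnorm_triangle x y : hnorm (x + y) <= hnorm x + hnorm y.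
Proof. by have := ler_normD x y; rewrite -!hnormE -rmorphD lecR. Qed.

Lemma hnorm_eq0 x : (hnorm x == 0) = (x == 0).
Proof. by rewrite -(inj_eq (@complexI R)) hnormE normr_eq0. Qed.

Lemma innerZr c x y : inner H x (c *: y) = c^* * inner H x y.
Proof. by rewrite linearZr_LR. Qed.

Lemma innerZr_real (c : R) x y : inner H x (c%:C *: y) = c%:C * inner H x y.
Proof. by rewrite innerZr; congr (_ * _); exact: conjc_real. Qed.

Lemma innerZl c x y : inner H (c *: x) y = c * inner H x y.
Proof. by rewrite linearZl_LR. Qed.

Lemma inner_sym x y : inner H x y = (inner H y x)^*.
Proof. by rewrite hermC expr0 mul1r. Qed.

Definition orthonormal_system (I : eqType) (w : I -> H) :=
  forall i j, inner H (w i) (w j) = (i == j)%:R.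

Lemma hnorm_orthonormal (I : eqType) (w : I -> H) i :
  orthonormal_system w -> hnorm (w i) = 1.
Proof.
move=> w1; apply/eqP; rewrite -(@eqrXn2 _ 2) ?hnorm_ge0//.
apply/eqP/(@complexI R); rewrite rmorphXn/= hnormE -inner_norm w1 eqxx.
by rewrite expr1n.
Qed.

Lemma inner_suml (I : finType) (c : I -> R[i]) (w : I -> H) x :
  inner H (\sum_i c i *: w i) x = \sum_i c i * inner H (w i) x.
Proof.
elim/big_ind2: _ => [|a b a' b' <- <-|i _]; first exact: linear0l.
  exact: linearDl.
exact: innerZl.
Qed.

Lemma orthonormal_coord (I : finType) (w : I -> H) (c : I -> R[i]) j :
  orthonormal_system w -> inner H (\sum_i c i *: w i) (w j) = c j.
Proof.
move=> w1; rewrite inner_suml (bigD1 j)//= w1 eqxx mulr1 big1 ?addr0// => i ij.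
by rewrite w1 (negPf ij) mulr0.
Qed.

Lemma pythagoras (I : finType) (w : I -> H) (c : I -> R[i]) :
  orthonormal_system w -> `|\sum_i c i *: w i| ^+ 2 = \sum_i `|c i| ^+ 2.
Proof.
move=> w1; rewrite -inner_norm inner_suml; apply: eq_bigr => i _.
by rewrite inner_sym orthonormal_coord// normCK.
Qed.

(** The component of [x] orthogonal to the system [w]. *)
Definition residual (I : finType) (w : I -> H) x :=
  x - \sum_i inner H x (w i) *: w i.

Lemma residual_orthogonal (I : finType) (w : I -> H) x j :
  orthonormal_system w -> inner H (residual w x) (w j) = 0.
Proof. by move=> w1; rewrite linearBl/= orthonormal_coord// subrr. Qed.

Lemma bessel (I : finType) (w : I -> H) x :
  orthonormal_system w -> \sum_i `|inner H x (w i)| ^+ 2 <= `|x| ^+ 2.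
Proof.
move=> w1; set p := \sum_i inner H x (w i) *: w i.
have rp : inner H p (residual w x) = 0.
  rewrite inner_suml big1// => i _.
  by rewrite (inner_sym (w i)) residual_orthogonal// conjc0 mulr0.
rewrite -(pythagoras _ w1) -/p.
have -> : x = p + residual w x by rewrite addrC subrK.
have pyth : inner H (p + residual w x) (p + residual w x) =
    inner H p p + inner H (residual w x) (residual w x) by exact: hnormDd.
by rewrite -[X in _ <= X]inner_norm pyth !inner_norm lerDl exprn_ge0.
Qed.

End Hilbert.

Lemma hnorm_le (R : realType) (H H' : hilbert R) (x : H) (y : H') (C : R) :
  (`|x| <= C%:C * `|y|) = (hnorm x <= C * hnorm y).
Proof. by rewrite -!hnormE -rmorphM lecR. Qed.

Lemma orthonormal_differences (R : realType) (H : hilbert R) (n : nat)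
    (w : nat -> H) (p q : 'I_n -> nat) :
  orthonormal_system w -> injective p -> injective q ->
  (forall i j, p i != q j) ->
  orthonormal_system (fun i => ((Num.sqrt 2)^-1)%:C *: (w (p i) - w (q i))).
Proof.
move=> w1 pI qI pq i j; rewrite innerZl innerZr_real.
rewrite linearBl/= !linearBr/= !w1 (inj_eq pI) (inj_eq qI).
rewrite (negPf (pq i j)) eq_sym [q i == _]eq_sym (negPf (pq j i)) eq_sym.
rewrite !mulr0n !mulr0 subr0 sub0r opprK mulrA -mulrDl -rmorphM -rmorphD.
by rewrite -invfM -expr2 sqr_sqrtr// -div1r -splitr rmorph1 mul1r.
Qed.

Section GramSchmidt.
Variables (R : realType) (H : hilbert R).
Implicit Types (w : nat -> H) (x : H).

(** The index type stays [nat] while [n] grows, so that a system is extended by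
    an [update] instead of a change of type. *)
Definition orthonormal_upto n w :=
  forall i j, (i < n)%N -> (j < n)%N -> inner H (w i) (w j) = (i == j)%:R.

Lemma orthonormal_uptoP n w :
  orthonormal_upto n w -> orthonormal_system (fun i : 'I_n => w i).
Proof. by move=> w1 i j; rewrite w1. Qed.

Definition gram_schmidt n w x : H :=
  let r := residual (fun i : 'I_n => w i) x in ((hnorm r)^-1)%:C *: r.

Definition update (T : Type) (s : nat -> T) n y :=
  fun i => if i == n then y else s i.

Lemma update_lt (T : Type) (s : nat -> T) n y i :
  (i < n)%N -> update s n y i = s i.
Proof. by move=> ltin; rewrite /update ltn_eqF. Qed.

Lemma update_eq (T : Type) (s : nat -> T) n y : update s n y n = y.
Proof. by rewrite /update eqxx. Qed.

Lemma orthonormal_update n w y : orthonormal_upto n w ->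
  (forall i, (i < n)%N -> inner H y (w i) = 0) -> inner H y y = 1 ->
  orthonormal_upto n.+1 (update w n y).
Proof.
move=> w1 yw yy i j; rewrite !ltnS /update.
have [->|ni] := eqVneq i n; have [->|nj] := eqVneq j n => lti ltj.
- by rewrite yy.
- by rewrite yw// ltn_neqAle nj.
- by rewrite (negPf ni) inner_sym yw ?conjc0// ltn_neqAle ni.
- by rewrite w1// ltn_neqAle ?ni ?nj.
Qed.

Lemma gram_schmidt_orthonormal n w x : orthonormal_upto n w ->
  residual (fun i : 'I_n => w i) x != 0 ->
  orthonormal_upto n.+1 (update w n (gram_schmidt n w x)).
Proof.
move=> w1 r0; have w1' := orthonormal_uptoP w1.
apply: orthonormal_update => //.
  move=> i lti; rewrite innerZl.
  by rewrite (residual_orthogonal x (Ordinal lti) w1') mulr0.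
rewrite inner_norm -hnormE hnormZ ger0_norm ?invr_ge0 ?hnorm_ge0//.
by rewrite mulVf ?hnorm_eq0// rmorph1 expr1n.
Qed.

Lemma gram_schmidt_decomposition n w x :
  let r := residual (fun i : 'I_n => w i) x in
  r != 0 -> (hnorm r)%:C *: gram_schmidt n w x = r.
Proof.
move=> r r0; rewrite /gram_schmidt scalerA -rmorphM divff ?hnorm_eq0//.
by rewrite rmorph1 scale1r.
Qed.

End GramSchmidt.

(** * Almost orthogonal differences of a bounded sequence *)

(** Cut [-M, M] into boxes of side [e]: the family [z k] is determined up to [e]
    by the finitely many possible box numbers, so two indices share them. *)
Lemma bounded_sequence_close_pair (R : realType) (I : finType)
    (z : nat -> I -> R) (M e : R) (N : nat) :
  0 < e -> (forall k i, `|z k i| <= M) ->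
  exists k l, [/\ (N <= k)%N, (k < l)%N & forall i, `|z k i - z l i| <= e].
Proof.
move=> e0 zM.
pose box k i := Num.truncn ((z k i + M) / e).
pose m := Num.truncn ((M + M) / e).
have boxm k i : (box k i < m.+1)%N.
  rewrite ltnS le_truncn// ler_pM2r ?invr_gt0// lerD2r.
  by apply: le_trans (zM k i); rewrite ler_norm.
pose T := {ffun I -> 'I_m.+1}.
pose c (k : 'I_#|T|.+1) : T := [ffun i => inord (box (N + k)%N i)].
have /injectivePn[k [l kl ckl]] : ~~ injectiveb c.
  by apply/injectiveP => /leq_card; rewrite card_ord ltnn.
have close i : `|z (N + k)%N i - z (N + l)%N i| <= e.
  have := congr1 (fun f : T => val (f i)) ckl.
  rewrite /c/= !ffunE/= !inordK// /box => tkl.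
  have pos j : 0 <= (z j i + M) / e.
    apply: divr_ge0; last exact: ltW.
    by have := zM j i; rewrite ler_norml; lra.
  have /andP[lk uk] := truncn_itv (pos (N + k)%N).
  have /andP[ll ul] := truncn_itv (pos (N + l)%N).
  move: lk uk ll ul; rewrite tkl -natr1; set t := _%:R.
  rewrite ler_pdivlMr// ltr_pdivrMr// ler_pdivlMr// ltr_pdivrMr//.
  by rewrite ler_norml !mulrDl mul1r; lra.
wlog ltkl : k l kl ckl close / (k < l)%N => [wl|].
  have [|] := ltnP k l; first exact: wl.
  rewrite leq_eqVlt => /orP[/eqP/val_inj/eqP|]; first by rewrite eq_sym (negPf kl).
  by apply: wl => //; [rewrite eq_sym|move=> i; rewrite distrC].
exists (N + k)%N, (N + l)%N; split => //; first exact: leq_addr.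
by rewrite ltn_add2l.
Qed.

Lemma normc_le_ReIm (R : realType) (c : R[i]) :
  `|c| <= (`|complex.Re c| + `|complex.Im c|)%:C.
Proof.
rewrite normc_def lecR -[leRHS]ger0_norm ?addr_ge0// -sqrtr_sqr ler_wsqrtr//.
rewrite sqrrD !real_normK ?num_real// addrAC lerDl.
by rewrite mulrn_wge0// mulr_ge0.
Qed.

(** Greedy choice of the pairs [(p i, q i)]: once [w] has [n] vectors, the
    pigeonhole principle applied to the coordinates of the [F k] along [w]
    gives a later pair whose difference is almost orthogonal to [w].  Its
    residual is nonzero since [d < c], and normalizing it gives [w n]. *)
Lemma almost_orthogonal_differences (R : realType) (H : hilbert R)
    (F : nat -> H) (M c d : R) (n : nat) :
  (forall k, hnorm (F k) <= M) ->
  (forall k l, (k < l)%N -> c <= hnorm (F k - F l)) ->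
  0 < d -> d < c ->
  exists (p q : nat -> nat) (w : nat -> H) (r : nat -> R),
  [/\ forall i, (i < n)%N -> (p i < q i)%N,
      forall i j, (i < j)%N -> (j < n)%N -> (q i < p j)%N,
      orthonormal_upto n w &
      forall i, (i < n)%N -> 0 < r i /\
        hnorm (F (p i) - F (q i) - (r i)%:C *: w i) <= d].
Proof.
move=> FM Fc d0 dc; elim: n => [|n [p [q [w [r [pq qp w1 rd]]]]]].
  by exists id, id, (fun=> 0), (fun=> 0).
have w1' := orthonormal_uptoP w1.
(* Real and imaginary parts of [n] coordinates, each within [e], contribute
   at most [n * 2 * e <= d] to the component along [w]. *)
pose e := d / (n.*2.+1)%:R.
have e0 : 0 < e by rewrite divr_gt0.
have inner_le k (i : 'I_n) : `|inner H (F k) (w i)| <= M%:C.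
  have M0 : 0 <= M by exact: le_trans (hnorm_ge0 _) (FM k).
  apply: le_trans (_ : _ <= (hnorm (F k))%:C) _; last by rewrite lecR.
  rewrite hnormE -(@ler_pXn2r _ 2)// ?nnegrE ?normr_ge0//.
  apply: le_trans (bessel (F k) w1').
  by rewrite (bigD1 i)//= lerDl; apply: sumr_ge0 => j _; rewrite exprn_ge0.
pose part (b : bool) (z : R[i]) := if b then complex.Re z else complex.Im z.
pose z k (ib : 'I_n * bool) := part ib.2 (inner H (F k) (w ib.1)).
have zM k ib : `|z k ib| <= M.
  rewrite /z /part -lecR; apply: le_trans (inner_le k ib.1).
  rewrite normc_def lecR -sqrtr_sqr ler_wsqrtr//.
  by case: ifP => _; rewrite ?lerDl ?lerDr sqr_ge0.
(* The lower bound on [k] is beyond every [q i] used so far. *)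
have [k [l [Nk kl zkl]]] :=
  bounded_sequence_close_pair (\sum_(i < n) (q i).+1) e0 zM.
pose v := F k - F l; pose s := residual (fun i : 'I_n => w i) v.
have vs : hnorm (v - s) <= d.
  rewrite -lecR hnormE /s /residual opprB addrC subrK.
  apply: le_trans (ler_norm_sum _ _ _) _.
  apply: (@le_trans _ _ (\sum_(i < n) (e + e)%:C)).
    apply: ler_sum => i _; rewrite normrZ -hnormE.
    rewrite (hnorm_orthonormal i w1').
    rewrite mulr1; apply: le_trans (normc_le_ReIm _) _.
    rewrite lecR lerD//.
      by have := zkl (i, true); rewrite /z/= -raddfB/= -linearBl.
    by have := zkl (i, false); rewrite /z/= -raddfB/= -linearBl.
  rewrite sumr_const card_ord -rmorphMn lecR -mulr2n -mulrnA mul2n.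
  rewrite -mulr_natr /e mulrAC ler_pdivrMr// ler_wpM2l ?(ltW d0)//.
  by rewrite ler_nat.
have s0 : s != 0.
  apply/eqP => s0; move: vs; rewrite s0 subr0 leNgt => /negP; apply.
  exact: lt_le_trans dc (Fc _ _ kl).
exists (update p n k), (update q n l), (update w n (gram_schmidt n w v)),
  (update r n (hnorm s)); split.
- move=> i; rewrite ltnS leq_eqVlt => /orP[/eqP->|lti]; first by rewrite !update_eq.
  by rewrite !update_lt// pq.
- move=> i j ij; rewrite ltnS leq_eqVlt => /orP[/eqP jn|ltj].
    rewrite jn in ij *; rewrite update_lt// update_eq; apply: leq_trans Nk.
    by rewrite (bigD1 (Ordinal ij))//= leq_addr.
  by rewrite !update_lt ?qp// (ltn_trans ij).
- exact: gram_schmidt_orthonormal.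
- move=> i; rewrite ltnS leq_eqVlt => /orP[/eqP->|lti]; last first.
    by rewrite !update_lt//; exact: rd.
  rewrite !update_eq gram_schmidt_decomposition//; split=> //.
  by rewrite lt_neqAle hnorm_ge0 andbT eq_sym hnorm_eq0.
Qed.

(** * Norms of columns *)

Section FineOpnorm.
Variables (R : realType) (V W : Type) (normV : V -> R) (normW : W -> R).
Variables (T : V -> W) (v0 : V).
Hypothesis v0_ball : normV v0 <= 1.

Lemma opnorm_ubound v : normV v <= 1 ->
  ((normW (T v))%:E <= opnorm normV normW T)%E.
Proof. by move=> v1; apply: ereal_sup_ubound; exists v. Qed.

Lemma opnorm_le (C : R) : (forall v, normV v <= 1 -> normW (T v) <= C) ->
  (opnorm normV normW T <= C%:E)%E.
Proof. by move=> TC; apply: ge_ereal_sup => _ [v v1 <-]; rewrite lee_fin TC. Qed.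

(** The vector [v0] rules out the value [-oo] of an empty supremum. *)
Lemma fine_opnorm_ubound v : (opnorm normV normW T < +oo)%E ->
  normV v <= 1 -> normW (T v) <= fine (opnorm normV normW T).
Proof.
move=> fT v1; rewrite -lee_fin fineK ?opnorm_ubound// fin_numE -ltey fT andbT.
by rewrite -ltNye (lt_le_trans _ (opnorm_ubound v0_ball)) ?ltNyr.
Qed.

Lemma fine_opnorm_le (C : R) : (forall v, normV v <= 1 -> normW (T v) <= C) ->
  fine (opnorm normV normW T) <= C.
Proof.
move=> /opnorm_le TC; rewrite -lee_fin fineK// fin_numE -ltey (le_lt_trans TC) ?ltry//.
by rewrite andbT -ltNye (lt_le_trans _ (opnorm_ubound v0_ball)) ?ltNyr.
Qed.

End FineOpnorm.

Lemma le_sqrt_sum_sqr (R : realType) (I : finType) (a : I -> R) i :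
  0 <= a i -> a i <= Num.sqrt (\sum_j a j ^+ 2).
Proof.
move=> a0; rewrite -[leLHS]ger0_norm// -sqrtr_sqr ler_wsqrtr// (bigD1 i)//=.
by rewrite lerDl; apply: sumr_ge0 => j _; rewrite sqr_ge0.
Qed.

(** A weak form of the triangle inequality in l^2, with the l^1 norm of [b],
    which avoids the Cauchy-Schwarz inequality: expand the square of the right
    hand side [S + B] and use [a i <= S] and [b i <= B]. *)
Lemma sqrt_sum_sqr_perturbation (R : realType) (I : finType) (a b c : I -> R) :
  (forall i, 0 <= a i) -> (forall i, 0 <= b i) -> (forall i, 0 <= c i) ->
  (forall i, c i <= a i + b i) ->
  Num.sqrt (\sum_i c i ^+ 2) <= Num.sqrt (\sum_i a i ^+ 2) + \sum_i b i.
Proof.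
move=> a0 b0 c0 cab; set S := Num.sqrt (\sum_i a i ^+ 2); set B := \sum_i b i.
have B0 : 0 <= B by apply: sumr_ge0.
have bB i : b i <= B by rewrite /B (bigD1 i)//= lerDl; apply: sumr_ge0.
have aS i : a i <= S by exact: le_sqrt_sum_sqr.
have SB0 : 0 <= S + B by rewrite addr_ge0 ?sqrtr_ge0.
rewrite -[leRHS]ger0_norm// -sqrtr_sqr ler_wsqrtr//.
have -> : (S + B) ^+ 2 = \sum_i (a i ^+ 2 + 2 * S * b i + b i * B).
  rewrite !big_split/= -mulr_sumr -mulr_suml -/B.
  rewrite -(@sqr_sqrtr _ (\sum_i a i ^+ 2)) -/S; first by ring.
  by apply: sumr_ge0 => i _; exact: sqr_ge0.
apply: ler_sum => i _.
apply: (@le_trans _ _ ((a i + b i) ^+ 2)).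
  by rewrite ler_pXn2r ?nnegrE ?addr_ge0.
have : a i * b i <= S * b i by rewrite ler_wpM2r.
have : b i * b i <= b i * B by rewrite ler_wpM2l.
nra.
Qed.

Lemma sqrt_sum_sqr_le_sum (R : realType) (I : finType) (b : I -> R) :
  (forall i, 0 <= b i) -> Num.sqrt (\sum_i b i ^+ 2) <= \sum_i b i.
Proof.
move=> b0; have := @sqrt_sum_sqr_perturbation R I (fun=> 0) b b.
rewrite (big1 _ _ (fun=> 0 ^+ 2)) ?sqrtr0 ?add0r => [|i _]; last by rewrite expr0n.
by apply=> // i; rewrite add0r.
Qed.

Section Columns.
Variables (R : realType) (X : opspace R).
Implicit Types (x : X) (v : ambient X).

Lemma hnorm0_le1 : hnorm (0 : ambient X) <= 1.
Proof. by rewrite hnorm0 ler01. Qed.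

Lemma val_bounded x : bounded_operators (ambient X) (val x).
Proof. by apply: subspace_bounded; apply: set_mem; exact: (valP x). Qed.

Lemma onorm_ubound x v : hnorm v <= 1 -> hnorm (val x v) <= onorm x.
Proof. by have [_ fx] := val_bounded x; exact: (fine_opnorm_ubound hnorm0_le1). Qed.

Lemma onorm_le x (C : R) :
  (forall v, hnorm v <= 1 -> hnorm (val x v) <= C) -> onorm x <= C.
Proof. exact: (fine_opnorm_le hnorm0_le1). Qed.

Lemma onorm_ge0 x : 0 <= onorm x.
Proof. exact: le_trans (hnorm_ge0 _) (onorm_ubound x hnorm0_le1). Qed.

Lemma opspace_valD x y v : val (x + y) v = val x v + val y v.
Proof. by rewrite raddfD. Qed.

Lemma opspace_valZ (c : R[i]) x v : val (c *: x) v = c *: val x v.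
Proof. by rewrite linearZ. Qed.

Lemma onorm_eq0 x : onorm x = 0 -> x = 0.
Proof.
move=> x0; apply/val_inj/funext => v /=.
have [xlin _] := val_bounded x.
have x0v : val x 0 = 0.
  by have := xlin (-1) 0 0; rewrite !scaleN1r !addNr.
have [->|v0] := eqVneq v 0; first by rewrite x0v.
have nv0 : 0 < hnorm v by rewrite lt_neqAle hnorm_ge0 andbT eq_sym hnorm_eq0.
pose a := (hnorm v)^-1.
have : hnorm (val x (a%:C *: v)) <= 0.
  rewrite -x0; apply: onorm_ubound.
  by rewrite hnormZ ger0_norm ?invr_ge0 ?hnorm_ge0// mulVf// gt_eqF.
rewrite -[_ *: v]addr0 xlin x0v addr0 hnormZ pmulr_rle0 ?normr_gt0 ?invr_eq0 ?gt_eqF// => h0.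
by apply/eqP; rewrite -hnorm_eq0 eq_le h0 hnorm_ge0.
Qed.

Lemma onorm_triangle x y : onorm (x + y) <= onorm x + onorm y.
Proof.
apply: onorm_le => v v1; rewrite opspace_valD.
by apply: le_trans (hnorm_triangle _ _) _; rewrite lerD ?onorm_ubound.
Qed.

Variable n : nat.
Implicit Types g h : 'I_n.+1 -> X.

Definition column_norm g := mxnorm (first_column g).

(** The action of a column on a vector: the matrix with first column [g] only
    sees the first coordinate of its argument, so [column_norm g] is the
    supremum of [column_at g] over the unit ball of the underlying space. *)
Definition column_at g v := Num.sqrt (\sum_i hnorm (val (g i) v) ^+ 2).

Lemma mxop_first_column g (k : 'cV[ambient X]_n.+1) :
  l2norm (mxop (map_mx val (first_column g)) k) = column_at g (k ord0 0).
Proof.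
congr (Num.sqrt _); apply: eq_bigr => i _; congr (hnorm _ ^+ 2).
rewrite mxE big_ord_recl !mxE/= big1 ?addr0// => j _.
by rewrite !mxE.
Qed.

Lemma l2norm_entry (k : 'cV[ambient X]_n.+1) i : hnorm (k i 0) <= l2norm k.
Proof.
exact: (@le_sqrt_sum_sqr _ _ (fun i => hnorm _)) (hnorm_ge0 _).
Qed.

Lemma opnorm_column_lty g : (opnorm (@l2norm _ (ambient X) n.+1)
  (@l2norm _ (ambient X) n.+1) (mxop (map_mx val (first_column g))) < +oo)%E.
Proof.
apply: (@le_lt_trans _ _ (\sum_i onorm (g i))%:E); last by rewrite ltry.
apply: opnorm_le => k k1; rewrite mxop_first_column.
apply: le_trans (sqrt_sum_sqr_le_sum _) _ => [i|]; first exact: hnorm_ge0.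
apply: ler_sum => i _.
by rewrite onorm_ubound// (le_trans (l2norm_entry _ _)).
Qed.

Lemma l2norm0_le1 : l2norm (0 : 'cV[ambient X]_n.+1) <= 1.
Proof.
rewrite /l2norm big1 ?sqrtr0// => i _.
by rewrite mxE hnorm0 expr0n.
Qed.

Lemma column_norm_ubound g v : hnorm v <= 1 -> column_at g v <= column_norm g.
Proof.
move=> v1; pose k : 'cV[ambient X]_n.+1 := \col_i (if i == ord0 then v else 0).
have -> : v = k ord0 0 by rewrite mxE.
rewrite -mxop_first_column; apply: fine_opnorm_ubound => //.
- exact: l2norm0_le1.
- exact: opnorm_column_lty.
rewrite /l2norm big_ord_recl big1 ?addr0; last first.
  by move=> i _; rewrite mxE hnorm0 expr0n.
by rewrite mxE eqxx sqrtr_sqr ger0_norm ?hnorm_ge0.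
Qed.

Lemma column_norm_le g (C : R) :
  (forall v, hnorm v <= 1 -> column_at g v <= C) -> column_norm g <= C.
Proof.
move=> gC; apply: fine_opnorm_le; first exact: l2norm0_le1.
move=> k k1; rewrite mxop_first_column gC//.
exact: le_trans (l2norm_entry _ _) k1.
Qed.

Lemma column_norm_ge0 g : 0 <= column_norm g.
Proof. exact: le_trans (sqrtr_ge0 _) (column_norm_ubound g hnorm0_le1). Qed.

Lemma column_norm_perturbation g h :
  column_norm h <= column_norm g + \sum_i onorm (h i - g i).
Proof.
apply: column_norm_le => v v1.
apply: (@le_trans _ _ (column_at g v + \sum_i onorm (h i - g i))); last first.
  by rewrite lerD2r column_norm_ubound.
apply: (@sqrt_sum_sqr_perturbation _ _ (fun i => hnorm (val (g i) v))) => i;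
  rewrite ?onorm_ge0 ?hnorm_ge0//.
rewrite -[h i in leLHS](subrKC (g i)) opspace_valD.
apply: le_trans (hnorm_triangle _ _) _.
by rewrite lerD2l onorm_ubound.
Qed.

Lemma onorm_le_column_norm g i : onorm (g i) <= column_norm g.
Proof.
apply: onorm_le => v v1; apply: le_trans (column_norm_ubound g v1).
exact: (@le_sqrt_sum_sqr _ _ (fun i => hnorm _)) (hnorm_ge0 _).
Qed.

Lemma column_norm_le_sum g : column_norm g <= \sum_i onorm (g i).
Proof.
apply: column_norm_le => v v1.
apply: le_trans (sqrt_sum_sqr_le_sum _) _ => [i|]; first exact: hnorm_ge0.
by apply: ler_sum => i _; rewrite onorm_ubound.
Qed.

Lemma column_normZ_le g (c : R) : 0 <= c ->
  column_norm (fun i => c%:C *: g i) <= c * column_norm g.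
Proof.
move=> c0; apply: column_norm_le => v v1.
rewrite /column_at; under eq_bigr do rewrite opspace_valZ hnormZ ger0_norm// exprMn.
rewrite -mulr_sumr sqrtrM ?sqr_ge0// sqrtr_sqr ger0_norm// ler_wpM2l//.
exact: column_norm_ubound.
Qed.

Lemma column_normZ g (c : R) : 0 < c ->
  column_norm (fun i => c%:C *: g i) = c * column_norm g.
Proof.
move=> c0; apply/le_anti/andP; split; first exact/column_normZ_le/ltW.
rewrite mulrC -ler_pdivlMr// mulrC.
have -> : column_norm g = column_norm (fun i => c^-1%:C *: (c%:C *: g i)).
  congr column_norm; apply/funext => i.
  by rewrite scalerA -rmorphM mulVf ?gt_eqF// rmorph1 scale1r.
by apply: column_normZ_le; rewrite invr_ge0 ltW.
Qed.

Lemma first_columnB g h :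
  first_column g - first_column h = first_column (fun i => g i - h i).
Proof.
by apply/matrixP => i j; rewrite !mxE; case: ifP => // _; rewrite subrr.
Qed.

End Columns.

Section Amplification.
Variables (R : realType) (X Y : opspace R) (n : nat).
Implicit Types g h : 'I_n.+1 -> X.

Lemma map_first_columnB (f : X -> Y) g h :
  map_mx f (first_column g) - map_mx f (first_column h) =
  first_column (fun i => f (g i) - f (h i)).
Proof.
by apply/matrixP => i j; rewrite !mxE; case: ifP => // _; rewrite subrr.
Qed.

(** Homogeneity bounds the amplification of [u] on the unit ball.  The column is
    rescaled by [a], slightly larger than its norm, so that a column of
    norm [0] needs no separate treatment. *)
Lemma homogeneous_column_norm (u : {linear X -> X}) (C : R) g :
  homogeneous X -> 0 <= C -> (forall x, onorm (u x) <= C * onorm x) ->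
  column_norm (fun i => u (g i)) <= C * column_norm g.
Proof.
move=> Xhom C0 uC; apply/ler_addgt0Pr => e e0.
have uopC : (opnorm (@onorm _ X) (@onorm _ X) u <= C%:E)%E.
  apply: opnorm_le => x x1; apply: le_trans (uC x) _.
  by rewrite -[leRHS]mulr1 ler_wpM2l.
have un (A : 'M[X]_n.+1) : mxnorm A <= 1 -> mxnorm (map_mx u A) <= C.
  move=> A1; rewrite -lee_fin; apply: (le_trans _ uopC).
  rewrite -Xhom; last exact: le_lt_trans uopC (ltry _).
  apply: le_trans (opnorm_ubound (@mxnorm _ X n.+1) (@map_mx _ _ u _ _) A1) _.
  by apply: ereal_sup_ubound; exists n.+1.
pose a := column_norm g + e / (C + 1).
have C1 : 0 < C + 1 by rewrite ltr_wpDl.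
have a0 : 0 < a by rewrite ltr_wpDl ?column_norm_ge0 ?divr_gt0.
have aV0 : 0 <= a^-1 by rewrite invr_ge0 ltW.
have : column_norm (fun i => u (a^-1%:C *: g i)) <= C.
  have -> : column_norm (fun i => u (a^-1%:C *: g i)) =
      mxnorm (map_mx u (first_column (fun i => a^-1%:C *: g i))).
    congr (mxnorm _); apply/matrixP => i j; rewrite !mxE.
    by case: ifP => // _; rewrite linear0.
  apply: un; apply: le_trans (column_normZ_le _ aV0) _.
  by rewrite mulrC ler_pdivrMr// mul1r lerDl divr_ge0 ?ltW.
move=> uaC.
have -> : (fun i => u (g i)) = (fun i => a%:C *: u (a^-1%:C *: g i)).
  apply/funext => i; rewrite -linearZ scalerA -rmorphM divff ?gt_eqF//.
  by rewrite rmorph1 scale1r.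
apply: le_trans (column_normZ_le _ (ltW a0)) _.
apply: (@le_trans _ _ (a * C)); first by rewrite ler_wpM2l// ltW.
rewrite /a mulrDl mulrC lerD2l mulrAC ler_pdivrMr//.
by rewrite mulrDr mulr1 lerDl ltW.
Qed.

End Amplification.

(** * Columns in homogeneous Hilbertian spaces *)

Section DiagonalMap.
Variables (R : realType) (X : opspace R) (K : hilbert R) (J : {linear X -> K}).
Variables (I : finType) (e e' : I -> X) (a : I -> R).

(** The linear map that kills the orthogonal complement of [e] and sends
    [e i] to [a i *: e' i]. *)
Definition diagonal_map (x : X) : X :=
  \sum_i ((a i)%:C * inner K (J x) (J (e i))) *: e' i.

Fact diagonal_map_linear : linear diagonal_map.
Proof.
move=> c x y; rewrite /diagonal_map scaler_sumr -big_split; apply: eq_bigr => i _ /=.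
rewrite scalerA -scalerDl; congr (_ *: _).
by rewrite linearP linearPl/= mulrDr mulrCA.
Qed.

HB.instance Definition _ :=
  GRing.isLinear.Build _ _ _ _ diagonal_map diagonal_map_linear.

Hypothesis e1 : orthonormal_system (J \o e).

Lemma diagonal_mapZ i (c : R[i]) :
  diagonal_map (c *: e i) = ((a i)%:C * c) *: e' i.
Proof.
rewrite linearZ/= /diagonal_map (bigD1 i)//= big1 ?addr0 => [|j ji].
  by rewrite e1 eqxx mulr1 scalerA mulrC.
by rewrite e1 eq_sym (negPf ji) mulr0 scale0r.
Qed.

(** Pythagoras for [e'] and Bessel for [e]. *)
Lemma onorm_diagonal_map (K' : hilbert R) (J' : {linear X -> K'}) (C : R) x :
  hilbert_isometry J -> hilbert_isometry J' -> orthonormal_system (J' \o e') ->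
  0 <= C -> (forall i, `|a i| <= C) -> onorm (diagonal_map x) <= C * onorm x.
Proof.
move=> [Jiso _] [J'iso _] e'1 C0 aC.
rewrite -J'iso -Jiso -hnorm_le.
have CJ0 : 0 <= C%:C * `|J x| by rewrite mulr_ge0 ?ler0c.
rewrite -(@ler_pXn2r _ 2)// ?nnegrE ?normr_ge0//.
rewrite /diagonal_map linear_sum.
under eq_bigr do rewrite linearZ.
rewrite (pythagoras _ e'1) exprMn.
have := ler_wpM2l (exprn_ge0 2 (_ : 0 <= C%:C)) (bessel (J x) e1).
rewrite ler0c => /(_ C0); apply: le_trans.
rewrite mulr_sumr; apply: ler_sum => i _.
rewrite normrM exprMn ler_wpM2r ?exprn_ge0//.
rewrite ler_pXn2r ?nnegrE ?normr_ge0// ?ler0c//.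
by rewrite normc_def/= expr0n addr0 sqrtr_sqr lecR.
Qed.

End DiagonalMap.

Section Homogeneous.
Variables (R : realType) (X : opspace R).
Hypothesis X_homogeneous : homogeneous X.
Variable n : nat.
Implicit Types e g v h : 'I_n.+1 -> X.

(** The diagonal map with weights [b i / a i] sends the second column to the
    first one and has norm at most [C], hence completely bounded norm at most
    [C] by homogeneity. *)
Lemma orthogonal_column_norm_le e e' (a b : 'I_n.+1 -> R) (C : R) :
  orthonormal_family e -> orthonormal_family e' -> 0 <= C ->
  (forall i, 0 < a i) -> (forall i, 0 <= b i <= C * a i) ->
  column_norm (fun i => (b i)%:C *: e' i) <=
  C * column_norm (fun i => (a i)%:C *: e i).
Proof.
move=> [K [J [Jiso e1]]] [K' [J' [J'iso e'1]]] C0 a0 bCa.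
pose u := diagonal_map J e e' (fun i => b i / a i).
have -> : (fun i => (b i)%:C *: e' i) = (fun i => u ((a i)%:C *: e i)).
  apply/funext => i; rewrite /u diagonal_mapZ// -rmorphM divfK//.
  by rewrite gt_eqF.
apply: homogeneous_column_norm => // x.
apply: (onorm_diagonal_map e1 _ Jiso J'iso e'1 C0) => i.
have /andP[b0 bC] := bCa i.
by rewrite ger0_norm ?ler_pdivrMr// divr_ge0// ltW.
Qed.

(** Any two orthonormal families are exchanged by contractions, so their columns
    have the same norm and the choice made in [kappa] is immaterial. *)
Lemma kappaE e : orthonormal_family e -> kappa X n.+1 = column_norm e.
Proof.
have same e1 e2 : orthonormal_family e1 -> orthonormal_family e2 ->
    column_norm e2 <= column_norm e1.
  move=> o1 o2.
  have id1 (g : 'I_n.+1 -> X) : (fun i => (1 : R)%:C *: g i) = g.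
    by apply/funext => i; rewrite rmorph1 scale1r.
  rewrite -[leRHS]mul1r -[in leLHS](id1 e2) -[in leRHS](id1 e1).
  apply: (orthogonal_column_norm_le o1 o2) => // i.
  by rewrite mulr1 ler01 lexx.
move=> o; apply: xget_unique; first by exists e.
by move=> _ [e' o' <-]; apply/le_anti/andP; split; exact: same.
Qed.

(** The column [v] differs by at most [(n + 1) d] from an orthogonal column whose
    entries have norms [r i] between [m - d] and [M + d], and diagonal maps
    compare the latter with the orthonormal column [g]. *)
Lemma column_norm_near_orthogonal g v (r : 'I_n.+1 -> R) (m M d : R) :
  orthonormal_family g -> (forall i, 0 < r i) ->
  (forall i, onorm (v i - (r i)%:C *: g i) <= d) ->
  (forall i, m <= onorm (v i) <= M) -> d < m ->
  column_norm v <= (M + d) * kappa X n.+1 + d *+ n.+1 /\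
  (m - d) * kappa X n.+1 <= column_norm v + d *+ n.+1.
Proof.
move=> g1 r0; pose rg i := (r i)%:C *: g i => vrg mvM dm.
have [K [J [Jiso Jg1]]] := g1.
have rgn i : onorm (rg i) = r i.
  rewrite -Jiso.1 linearZ hnormZ/= (@hnorm_orthonormal _ _ _ (J \o g))//.
  by rewrite mulr1 gtr0_norm.
have rgv i : onorm (rg i - v i) <= d.
  by rewrite -Jiso.1 -opprB linearN /hnorm normrN -/(hnorm _) Jiso.1 vrg.
have r_le i : r i <= M + d.
  rewrite -rgn -[rg i](subrKC (v i)); apply: le_trans (onorm_triangle _ _) _.
  by rewrite lerD//; have /andP[] := mvM i.
have r_ge i : m - d <= r i.
  rewrite -rgn lerBlDr; have /andP[/le_trans + _] := mvM i; apply.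
  rewrite -{1}[v i](subrKC (rg i)); apply: le_trans (onorm_triangle _ _) _.
  by rewrite lerD2l.
have sum_d h : (forall i, onorm (h i) <= d) -> \sum_i onorm (h i) <= d *+ n.+1.
  move=> hd; apply: le_trans (ler_sum _ (fun i _ => hd i)) _.
  by rewrite sumr_const card_ord.
have kX : kappa X n.+1 = column_norm (fun i => (1 : R)%:C *: g i).
  by rewrite column_normZ// mul1r; exact: kappaE.
split.
  apply: le_trans (column_norm_perturbation rg v) _; rewrite lerD ?sum_d//.
  rewrite kX; apply: orthogonal_column_norm_le => //.
    exact: le_trans (ltW (r0 ord0)) (r_le ord0).
  by move=> i; rewrite mulr1 r_le ltW.
apply: (@le_trans _ _ (column_norm rg)); last first.
  by apply: le_trans (column_norm_perturbation v rg) _; rewrite lerD2l sum_d.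
have c0 : 0 < m - d by rewrite subr_gt0.
rewrite mulrC -ler_pdivlMr// mulrC kX.
apply: orthogonal_column_norm_le => //; first by rewrite invr_ge0 ltW.
by move=> i; rewrite ler01 mulrC ler_pdivlMr// mul1r r_ge.
Qed.

End Homogeneous.

Section OrthonormalSequence.
Variables (R : realType) (X : opspace R).

Lemma isometry_inj (K : hilbert R) (J : {linear X -> K}) :
  hilbert_isometry J -> injective J.
Proof.
move=> [Jiso _]; apply: raddf_inj => x Jx0.
by apply: onorm_eq0; rewrite -Jiso Jx0 hnorm0.
Qed.

(** A vector outside the span of [e 0, ..., e n.-1] has a nonzero residual. *)
Lemma orthonormal_extension (K : hilbert R) (J : {linear X -> K}) n
    (e : nat -> X) :
  hilbert_isometry J -> infinite_dimensional X ->
  exists y, orthonormal_upto n (J \o e) ->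
            orthonormal_upto n.+1 (J \o update e n y).
Proof.
move=> Jiso Xinf.
have [x xe] : exists x, forall c : 'I_n -> R[i], x <> \sum_i c i *: e i.
  apply: contrapT => /forallNP nx; apply: Xinf; exists n, (fun i => e i) => x.
  by apply: contrapT => /forallNP; exact: nx.
have [y Jy] := Jiso.2 (gram_schmidt n (J \o e) (J x)).
exists y => e1.
have -> : J \o update e n y = update (J \o e) n (J y).
  by apply/funext => i; rewrite /update/=; case: ifP.
rewrite Jy; apply: gram_schmidt_orthonormal => //.
apply/eqP => /subr0_eq Jx; apply: (xe (fun i => inner K (J x) (J (e i)))).
apply: (isometry_inj Jiso); rewrite [LHS]Jx linear_sum.
by apply: eq_bigr => i _; rewrite linearZ.
Qed.

Lemma orthonormal_sequence (K : hilbert R) (J : {linear X -> K}) :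
  hilbert_isometry J -> infinite_dimensional X ->
  exists e : nat -> X, orthonormal_system (J \o e).
Proof.
move=> Jiso Xinf.
have /choice[E EP] : forall se : nat * (nat -> X), exists y,
    orthonormal_upto se.1 (J \o se.2) ->
    orthonormal_upto se.1.+1 (J \o update se.2 se.1 y).
  by move=> [n e]; exact: orthonormal_extension.
(* Each [s n] agrees with the next one below [n], so they have a limit [e]. *)
pose s := fix s n := if n is m.+1 then update (s m) m (E (m, s m)) else fun=> 0.
have s1 n : orthonormal_upto n (J \o s n).
  by elim: n => [//|n IHn]; exact: (EP (n, s n)).
pose e n := s n.+1 n.
have se n i : (i < n)%N -> s n i = e i.
  elim: n => // n IHn; rewrite ltnS leq_eqVlt => /orP[/eqP->//|ltin].
  by rewrite /= update_lt// IHn.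
exists e => i j.
have lti : (i < (maxn i j).+1)%N by rewrite ltnS leq_maxl.
have ltj : (j < (maxn i j).+1)%N by rewrite ltnS leq_maxr.
by have := s1 _ i j lti ltj; rewrite /comp !se.
Qed.

End OrthonormalSequence.

(** * Comparison of the column sequences *)

Lemma le_of_small_perturbation (R : realFieldType) (a b D c : R) :
  0 < c -> 0 <= D -> (forall d, 0 < d -> d < c -> a <= b + d * D) -> a <= b.
Proof.
move=> c0 D0 ab; apply/ler_addgt0Pr => e e0.
have D1 : 0 < D + 1 by rewrite ltr_wpDl.
pose d := Num.min (c / 2) (e / (D + 1)).
have d0 : 0 < d by rewrite lt_min !divr_gt0.
have dc : d < c by rewrite gt_min; apply/orP; left; lra.
apply: le_trans (ab d d0 dc) _; rewrite lerD2l.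
have : d <= e / (D + 1) by rewrite ge_min lexx orbT.
by rewrite ler_pdivlMr// mulrDr mulr1; lra.
Qed.

Lemma interlaced_disjoint n (p q : 'I_n -> nat) :
  (forall i, (p i < q i)%N) ->
  (forall i j : 'I_n, (i < j)%N -> (q i < p j)%N) ->
  [/\ injective p, injective q & forall i j, p i != q j].
Proof.
move=> pq qp; split=> [i j pij|i j qij|i j].
- apply: val_inj; case: (ltngtP i j) => // /qp.
    by rewrite -pij ltnNge ltnW.
  by rewrite pij ltnNge ltnW.
- apply: val_inj; case: (ltngtP i j) => // /qp.
    by rewrite qij ltnNge ltnW.
  by rewrite -qij ltnNge ltnW.
- case: (ltngtP i j) => [/qp ij|/qp ij|/val_inj->].
  + by rewrite ltn_eqF// (ltn_trans (pq i))// (ltn_trans ij).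
  + by rewrite gtn_eqF.
  + by rewrite ltn_eqF.
Qed.

Section Embedding.
Variables (R : realType) (X Y : opspace R) (f : X -> Y) (L : R).
Hypotheses (X_homogeneous : homogeneous X) (Y_homogeneous : homogeneous Y).
Hypotheses (X_infdim : infinite_dimensional X).
Hypotheses (X_hilbertian : hilbertian X) (Y_hilbertian : hilbertian Y).
Hypothesis L1 : 1 <= L.
Hypothesis fL : forall n : nat, (0 < n)%N -> forall x y : 'M[X]_n,
  mxnorm x <= 1 -> mxnorm y <= 1 ->
  L^-1 * mxnorm (x - y) <= mxnorm (map_mx f x - map_mx f y)
        <= L * mxnorm (x - y).

Lemma embedding_column_norm n (g h : 'I_n.+1 -> X) :
  column_norm g <= 1 -> column_norm h <= 1 ->
  L^-1 * column_norm (fun i => g i - h i) <=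
  column_norm (fun i => f (g i) - f (h i)) <=
  L * column_norm (fun i => g i - h i).
Proof.
move=> g1 h1; have := fL (ltn0Sn n) g1 h1.
by rewrite map_first_columnB first_columnB.
Qed.

(** The case of 1 x 1 matrices. *)
Lemma embedding_onorm x y : onorm x <= 1 -> onorm y <= 1 ->
  L^-1 * onorm (x - y) <= onorm (f x - f y) <= L * onorm (x - y).
Proof.
have cn (Z : opspace R) (z : Z) : column_norm (fun _ : 'I_1 => z) = onorm z.
  apply/le_anti/andP; split; last exact: (onorm_le_column_norm (fun=> z) ord0).
  by apply: le_trans (column_norm_le_sum _) _; rewrite big_ord1.
move=> x1 y1; have := @embedding_column_norm 0 (fun=> x) (fun=> y).
by rewrite !cn; apply.
Qed.

(** The comparison at scale [s] with an error [d] still to be sent to [0]. *)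
Lemma kappa_almost_comparison n (s : R) : s = Num.sqrt 2 / n.+1%:R ->
  forall d, 0 < d -> d < L^-1 * s ->
  L^-1 * s * kappa X n.+1 <= (L * s + d) * kappa Y n.+1 + d *+ n.+1 /\
  (L^-1 * s - d) * kappa Y n.+1 <= L * s * kappa X n.+1 + d *+ n.+1.
Proof.
move=> sE d d0 dLs.
have L0 : 0 < L by apply: lt_le_trans L1.
have s0 : 0 < s by rewrite sE divr_gt0 ?sqrtr_gt0.
have [K [J Jiso]] := X_hilbertian; have [K' [J' J'iso]] := Y_hilbertian.
have [e e1] := orthonormal_sequence Jiso X_infdim.
(* A column of [n.+1] entries of norm [t] has norm at most [1]. *)
pose t : R := n.+1%:R^-1.
have t0 : 0 < t by rewrite invr_gt0.
have st : t = s * (Num.sqrt 2)^-1.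
  by rewrite sE mulrAC divff ?mul1r// gt_eqF// sqrtr_gt0.
pose x k := t%:C *: e k.
have xn k : onorm (x k) = t.
  rewrite -Jiso.1 linearZ hnormZ ger0_norm ?ltW//.
  by rewrite (hnorm_orthonormal k e1) mulr1.
have t1 : t <= 1 by rewrite invf_le1// ler1n.
pose dif m (p q : 'I_m -> nat) i := ((Num.sqrt 2)^-1)%:C *: (e (p i) - e (q i)).
have xdif m (p q : 'I_m -> nat) i : x (p i) - x (q i) = s%:C *: dif m p q i.
  by rewrite /x /dif scalerA -rmorphM -st scalerBr.
have dif1 m (p q : 'I_m -> nat) : injective p -> injective q ->
    (forall i j, p i != q j) -> orthonormal_system (J \o dif m p q).
  have -> : J \o dif m p q =
      fun i => ((Num.sqrt 2)^-1)%:C *: ((J \o e) (p i) - (J \o e) (q i)).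
    by apply/funext => i; rewrite /= linearZ linearB.
  exact: orthonormal_differences.
have xkl k l : (k < l)%N -> onorm (x k - x l) = s.
  move=> kl; rewrite (xdif 1 (fun=> k) (fun=> l) ord0) -Jiso.1 linearZ hnormZ.
  have o1 : orthonormal_system (J \o dif 1 (fun=> k) (fun=> l)).
    apply: dif1 => [i j _|i j _|_ _]; rewrite ?ord1 ?[j]ord1//.
    by rewrite ltn_eqF.
  by rewrite (hnorm_orthonormal ord0 o1) mulr1 ger0_norm// ltW.
have fxkl k l : (k < l)%N ->
    L^-1 * s <= onorm (f (x k) - f (x l)) <= L * s.
  by move=> kl; rewrite -(xkl k l kl); apply: embedding_onorm; rewrite ?xn.
pose F k := J' (f (x k)).
have F_sep k l : (k < l)%N -> L^-1 * s <= hnorm (F k - F l).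
  by move=> kl; rewrite -linearB J'iso.1; have /andP[] := fxkl _ _ kl.
have F_bounded k : hnorm (F k) <= hnorm (F 0) + L * s.
  case: k => [|k]; first by rewrite lerDl mulr_ge0 ?ltW.
  rewrite -[F k.+1](subKr (F 0)); apply: le_trans (hnorm_triangle _ _) _.
  rewrite lerD2l -scaleN1r -(rmorphN1 (real_complex R)) hnormZ normrN1 mul1r.
  by rewrite -linearB J'iso.1; have /andP[] := fxkl _ _ (ltn0Sn k).
have [p [q [w [r [pq qp w1 wr]]]]] :=
  almost_orthogonal_differences n.+1 F_bounded F_sep d0 dLs.
have J'g i : exists g, J' g = w i by exact: J'iso.2.
have [g gE] := choice J'g.
have g1 : orthonormal_family (fun i : 'I_n.+1 => g i).
  by exists K', J'; split=> // i j; rewrite !gE w1.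
pose P (i : 'I_n.+1) := p i; pose Q (i : 'I_n.+1) := q i.
have [PI QI PQ] : [/\ injective P, injective Q & forall i j, P i != Q j].
  by apply: interlaced_disjoint => i => [|j]; [exact: pq|move=> ij; exact: qp].
have D1 : orthonormal_family (dif n.+1 P Q) by exists K, J; split=> //; exact: dif1.
pose v i := f (x (P i)) - f (x (Q i)).
have vrg i : onorm (v i - (r i)%:C *: g i) <= d.
  have J'v : J' (v i - (r i)%:C *: g i) = F (p i) - F (q i) - (r i)%:C *: w i.
    by rewrite [LHS]linearB [J' (v i)]linearB [J' (_ *: _)]linearZ/= gE.
  by rewrite -J'iso.1 J'v; exact: (wr i (ltn_ord i)).2.
have [v_le_kY kY_le_v] := column_norm_near_orthogonal Y_homogeneous g1
  (fun i => (wr i (ltn_ord i)).1) vrg (fun i => fxkl _ _ (pq i (ltn_ord i))) dLs.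
have ball (k : 'I_n.+1 -> nat) : column_norm (fun i => x (k i)) <= 1.
  apply: le_trans (column_norm_le_sum _) _.
  under eq_bigr do rewrite xn.
  by rewrite sumr_const card_ord -mulr_natr mulVf ?pnatr_eq0.
have xPQ : column_norm (fun i => x (P i) - x (Q i)) = s * kappa X n.+1.
  rewrite (kappaE X_homogeneous D1) -column_normZ//.
  by congr column_norm; apply/funext => i; exact: xdif.
have := embedding_column_norm (ball P) (ball Q).
rewrite xPQ !mulrA => /andP[v_ge v_le].
split; first exact: le_trans v_ge v_le_kY.
by apply: le_trans kY_le_v _; rewrite lerD2r.
Qed.

Lemma kappa_comparison n :
  L^-1 * kappa X n.+1 <= L * kappa Y n.+1 /\
  L^-1 * kappa Y n.+1 <= L * kappa X n.+1.
Proof.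
pose s : R := Num.sqrt 2 / n.+1%:R.
have L0 : 0 < L by apply: lt_le_trans L1.
have s0 : 0 < s by rewrite divr_gt0 ?sqrtr_gt0.
have kappa_ge0 (Z : opspace R) : 0 <= kappa Z n.+1.
  by rewrite /kappa; case: xgetP => [_ -> [e _ <-]|//]; exact: column_norm_ge0.
have c0 : 0 < L^-1 * s by rewrite mulr_gt0 ?invr_gt0.
have close := kappa_almost_comparison (erefl s).
have XY : L^-1 * s * kappa X n.+1 <= L * s * kappa Y n.+1.
  apply: (@le_of_small_perturbation _ _ _ (kappa Y n.+1 + n.+1%:R) _ c0).
    by rewrite addr_ge0.
  move=> d d0 dc; have [+ _] := close d d0 dc.
  by rewrite -[d *+ _]mulr_natr mulrDr addrA -mulrDl.
have YX : L^-1 * s * kappa Y n.+1 <= L * s * kappa X n.+1.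
  apply: (@le_of_small_perturbation _ _ _ (kappa Y n.+1 + n.+1%:R) _ c0).
    by rewrite addr_ge0.
  move=> d d0 dc; have [_] := close d d0 dc.
  by rewrite -[d *+ _]mulr_natr; lra.
by split; rewrite -(ler_pM2l s0) mulrCA mulrA [leRHS]mulrCA [leRHS]mulrA.
Qed.

End Embedding.

Theorem theorem1p7 (R : realType) (X Y : opspace R)
  (X_infdim : infinite_dimensional X) (Y_infdim : infinite_dimensional Y)
  (X_homogeneous : homogeneous X) (Y_homogeneous : homogeneous Y)
  (X_hilbertian : hilbertian X) (Y_hilbertian : hilbertian Y)
  (f_ex : exists f : X -> Y, completely_lipschitz_small_scale_embedding f) :
  equivalent_sequences (kappa X) (kappa Y).
Proof.
have [f [L L1 fL]] := f_ex.
have L0 : 0 < L by apply: lt_le_trans L1.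
exists (L * L) => [|[//|n] _]; first by rewrite mulr_ege1.
have [XY YX] := kappa_comparison X_homogeneous Y_homogeneous X_infdim
  X_hilbertian Y_hilbertian L1 fL n.
move: XY YX; rewrite !ler_pdivrMl// !mulrA => XY YX.
by rewrite ler_pdivrMr ?mulr_gt0// [_ * (L * L)]mulrC XY.
Qed.
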